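(* $$\sup_{f,\,v\ :\ \int_0^1\hat f^{(v)}(u)^2\,du<\infty}\ \frac{\int_0^1\hat f^{(L)}(u,v)^2\,du}{\int_0^1\hat f^{(v)}(u)^2\,du}=4,$$ where the supremum is over all monotone estimation problems (monotone sampling schemes $(\mathbf V,S^* )$ together with functions $f:\mathbf V\to[0,\infty)$) and all data vectors $v\in\mathbf V$ for which the $v$-optimal estimate function $\hat f^{(v)}$ is square integrable on $(0,1]$, and $\hat f^{(L)}$ is the L* estimator for $f$. (The ratio $0/0$ is read as $0$.)
   Context: A monotone sampling scheme consists of a set $\mathbf V$ (the data domain) and a map assigning to each seed $u\in(0,1]$ and data vector $v\in\mathbf V$ a set $S^*(u,v)\subseteq\mathbf V$ with $v\in S^*(u,v)$, such that for each fixed $v$ the set $S^*(u,v)$ is non-decreasing (under inclusion) in $u$. The outcome (sample) $S(u,v)$ of data $v$ with seed $u$ includes the seed $u$, and $S^*(u,v)$ is the set of all data vectors consistent with the outcome: $z\in S^*(u,v)$ implies $S(u,z)=S(u,v)$ and $S^*(u,z)=S^*(u,v)$. Standing assumption: if $z\in S^*(\rho,v)$ then there is $\epsilon>0$ such that $z\in S^*(x,v)$ for all $x\in(\rho-\epsilon,1]\cap(0,1]$. Lower bound function: $\underline f^{(v)}(u)=\inf\{f(z): z\in S^*(u,v)\}$ for $u\in(0,1]$, with $\underline f^{(v)}(0)=\lim_{u\to0^+}\underline f^{(v)}(u)$. The $v$-optimal estimate function $\hat f^{(v)}:(0,1]\to[0,\infty)$ is the solution of $$\hat f^{(v)}(u)=\inf_{0\le\eta<u}\frac{\underline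 f^{(v)}(\eta)-\int_u^1\hat f^{(v)}(x)\,dx}{u-\eta};$$ geometrically, it is the negated (left) derivative of the lower convex hull of the graph of $\underline f^{(v)}$ on $(0,1)$ together with the point $(1,0)$. The L* estimator is the solution $\hat f^{(L)}$ of $\hat f^{(L)}(\rho,v)=\frac1\rho\big(\underline f^{(v)}(\rho)-\int_\rho^1\hat f^{(L)}(u,v)\,du\big)$ for all $v\in\mathbf V$, $\rho\in(0,1]$. *)

(* Defs.v *)
From HB Require Import structures.
From mathcomp Require Import all_boot all_order all_algebra.
From mathcomp Require Import all_classical all_reals all_analysis.

Set Implicit Arguments.
Unset Strict Implicit.
Unset Printing Implicit Defensive.

Import Order.TTheory GRing.Theory Num.Theory.
Import numFieldNormedType.Exports.

Local Open Scope classical_set_scope.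
Local Open Scope ring_scope.

(* [outcome Sstar u v] is the sample S(u,v).  An outcome carries the seed and
   exactly the information which data vectors are consistent with it. *)
Definition outcome (R V : Type) (Sstar : R -> V -> set V) (u : R) (v : V) :
    R * set V :=
  (u, Sstar u v).

(* Seeds range over ]0, 1]; the values of [Sstar] at other reals are
   unconstrained and never used. *)
Record monotone_sampling_scheme (R : realType) (V : Type) := MonotoneSampling {
  Sstar :> R -> V -> set V ;
  Sstar_refl : forall u v, 0 < u <= 1 -> Sstar u v v ;
  Sstar_mono : forall u u' v, 0 < u -> u <= u' -> u' <= 1 ->
    Sstar u v `<=` Sstar u' v ;
  Sstar_outcome : forall u v z, 0 < u <= 1 -> Sstar u v z ->
    outcome Sstar u z = outcome Sstar u v ;
  Sstar_open : forall rho v z, 0 < rho <= 1 -> Sstar rho v z ->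
    exists2 eps : R, 0 < eps &
      forall x, rho - eps < x -> 0 < x <= 1 -> Sstar x v z
}.

Lemma Sstar_consistent (R : realType) (V : Type)
    (S : monotone_sampling_scheme R V) (u : R) (v : V) : 0 < u <= 1 ->
  S u v = [set z | outcome S u z = outcome S u v].
Proof.
move=> u01; apply/seteqP; split=> z /=; first exact: Sstar_outcome.
by case=> <-; apply: Sstar_refl.
Qed.

(* Only used on [0, 1]; at a seed u in ]0, 1] the infimum is over a nonempty
   set bounded below by 0 as soon as f >= 0. *)
Definition lower_bound_fun (R : realType) (V : Type)
    (S : monotone_sampling_scheme R V) (f : V -> R) (v : V) (u : R) : R :=
  if 0 < u then inf (f @` S u v)
  else lim ((fun x => inf (f @` S x v)) x @[x --> (0 : R)^'+]).

(* Makes every integral over [u, 1] with 0 < u meaningful and entails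
   measurability on ]0, 1], without presupposing integrability at 0. *)
Definition integrable_away_from0 (R : realType) (g : R -> R) : Prop :=
  forall u : R, 0 < u <= 1 ->
    (@lebesgue_measure R).-integrable `[u, 1] (EFin \o g).

(* The infimum is taken in \bar R, because the real-valued [inf] of a set that
   is not bounded below is the junk value 0. *)
Definition is_v_optimal (R : realType) (V : Type)
    (S : monotone_sampling_scheme R V) (f : V -> R) (v : V) (g : R -> R)
    : Prop :=
  [/\ forall u, 0 < u <= 1 -> 0 <= g u,
      integrable_away_from0 g &
      forall u, 0 < u <= 1 ->
        (g u)%:E = ereal_inf
          [set ((lower_bound_fun S f v eta
                 - \int[@lebesgue_measure R]_(x in `[u, 1]) g x)
                / (u - eta))%:E | eta in `[0, u[ ]].

Definition is_Lstar (R : realType) (V : Type)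
    (S : monotone_sampling_scheme R V) (f : V -> R) (fL : R -> V -> R)
    : Prop :=
  forall v, integrable_away_from0 (fL ^~ v) /\
    forall rho, 0 < rho <= 1 ->
      fL rho v = rho^-1 * (lower_bound_fun S f v rho
                 - \int[@lebesgue_measure R]_(u in `[rho, 1]) fL u v).

Definition sq_integral (R : realType) (g : R -> R) : \bar R :=
  (\int[@lebesgue_measure R]_(u in `]0%R, 1%R]) ((g u) ^+ 2)%:E)%E.

(* The library's division in \bar R already reads 0 / 0 as 0; for c > 0
   it gives c / 0 = +oo. *)
Lemma ratio00 (R : realType) : (0 / 0 = 0 :> \bar R)%E.
Proof. by rewrite inve0 mul0e. Qed.

(* Main.v *)
(** Fix a datum, let h be its lower bound function, g the optimal estimate, l
    the L* estimate, a(x) and b(x) their integrals over ]0, x], and H = h(0).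
    Optimality gives [int_x^1 g <= h(x)] and [int_0^1 g = H], so the L* equation
    becomes [a - x l = H - h], which lies between 0 and b.  The exact derivatives
      [(a^2/x)' = l^2 - (a/x - l)^2]  and  [(b^2/x)' = 2 b g / x - (b/x)^2],
    together with [0 <= (2 g - b/x)^2], yield
      [l^2 <= 4 g^2 + (a^2/x)' - 2 (b^2/x)'],
    and integrating over [e, 1] leaves only the boundary term [2 b(e)^2/e], which
    Cauchy-Schwarz bounds by twice the integral of [g^2] over ]0, e].

    The constant is optimal: for p < 1/2 the estimate [g = x^(-p)] is optimal for
    [h = (1 - x^(1-p)) / (1-p)], its L* estimate is [l = (x^(-p) - 1) / p], and the
    ratio is [2 / (1-p)]. *)

Require Import Defs.
From mathcomp Require Import all_boot all_order all_algebra.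
From mathcomp Require Import all_classical all_reals all_analysis.
From mathcomp Require Import measurable_realfun ring lra.

Set Implicit Arguments.
Unset Strict Implicit.
Unset Printing Implicit Defensive.

Import Order.TTheory GRing.Theory Num.Theory.
Import numFieldNormedType.Exports.

Local Open Scope classical_set_scope.
Local Open Scope ring_scope.

(** * Indefinite Lebesgue integrals and integration by parts *)

Section indefinite_integrals.
Context {R : realType}.
Notation mu := (@lebesgue_measure R).
Implicit Types (s t u c : R) (a b f g : R -> R).

Lemma Rintegral_itv_split s u t f : s <= u -> u <= t ->
  mu.-integrable `[s, t] (EFin \o f) ->
  \int[mu]_(x in `[s, t]) f x =
  \int[mu]_(x in `[s, u]) f x + \int[mu]_(x in `[u, t]) f x.
Proof.
move=> su ut intf.
have := @Rintegral_itvB R f (BLeft s) (BRight t) u intf.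
rewrite !bnd_simp => /(_ su ut) /eqP.
rewrite subr_eq addrC => /eqP ->; congr (_ + _).
rewrite Rintegral_itv_obnd_cbnd//.
apply: integrableS intf => //=.
by apply: subset_itv => //; rewrite bnd_simp.
Qed.

Lemma Rintegral_itv_cst s t c : s <= t ->
  \int[mu]_(x in `[s, t]) c = c * (t - s).
Proof.
move=> st; rewrite Rintegral_cst//; congr (_ * _).
have -> : fine (mu `[s, t]%classic) = t - s => //.
rewrite lebesgue_measure_itv/= lte_fin.
by move: st; rewrite le_eqVlt => /predU1P[->|->//]; rewrite ltxx subrr.
Qed.

Lemma integrable_itv_cst s t c : mu.-integrable `[s, t] (EFin \o (fun=> c)).
Proof.
apply: continuous_compact_integrable; first exact: segment_compact.
by apply: continuous_subspaceT => x; exact: cvg_cst.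
Qed.

(** Both sides are iterated integrals of [f x * g y] over the triangle [s <= y <= x <= t]. Fubini
    applies because the kernel is dominated by [|F x| * |G y|], whose integral is a product of two
    finite factors. *)
Lemma triangle_Fubini s t f g :
  mu.-integrable `[s, t] (EFin \o f) -> mu.-integrable `[s, t] (EFin \o g) ->
  \int[mu]_(x in `[s, t]) (f x * \int[mu]_(y in `[s, x]) g y) =
  \int[mu]_(y in `[s, t]) (g y * \int[mu]_(x in `[y, t]) f x).
Proof.
move=> intf intg.
pose F := f \_ `[s, t]; pose G := g \_ `[s, t].
have intF : mu.-integrable setT (EFin \o F).
  by rewrite /F -restrict_EFin; apply/(integrable_restrict mu) => //; rewrite setTI.
have intG : mu.-integrable setT (EFin \o G).
  by rewrite /G -restrict_EFin; apply/(integrable_restrict mu) => //; rewrite setTI.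
have mF : measurable_fun setT F by apply/measurable_EFinP; case/integrableP: intF.
have mG : measurable_fun setT G by apply/measurable_EFinP; case/integrableP: intG.
pose D : set (R * R) := [set z | z.2 <= z.1].
have mD : measurable D.
  rewrite -[D]setTI; apply: measurable_fun_le => //.
pose k (z : R * R) : \bar R := (F z.1 * G z.2 * \1_D z)%:E.
have mk : measurable_fun setT k.
  apply/measurable_EFinP; apply: measurable_funM; last exact: measurable_indic.
  by apply: measurable_funM; apply: measurableT_comp.
have intk : (mu \x mu)%E.-integrable setT k.
  apply/integrable12ltyP => //.
  apply: (@le_lt_trans _ _ (\int[mu]_x ((`|F x| * \int[mu]_y `|G y|)%R%:E))%E).
    apply: ge0_le_integral => //.
    - by move=> x _; apply: integral_ge0.
    - have mak : measurable_fun setT (abse \o k) by exact: measurableT_comp.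
      have := measurable_fun_fubini_tonelli_F (m2 := lebesgue_measure) _ mak.
      by apply=> z; exact: abse_ge0.
    - by apply/measurable_EFinP; apply: measurable_funM => //; apply: measurableT_comp.
    - move=> x _; rewrite EFinM /Rintegral fineK; last exact/integrable_fin_num/integrable_norm.
      rewrite -ge0_integralZl//.
      + apply: ge0_le_integral => //.
        * by apply: measurableT_comp => //; apply: measurableT_comp => //.
        * apply/measurable_EFinP; apply: measurable_funM => //.
          exact: measurableT_comp.
        * move=> y _; rewrite /k/= -!EFinM lee_fin !normrM ler_piMr//.
          by rewrite indicE; case: (_ \in _); rewrite ?normr1 ?normr0.
      + by apply/measurable_EFinP; exact: measurableT_comp.
  under eq_integral do rewrite EFinM.
  rewrite integralZr//=; last exact: integrable_norm.
  have intnF : mu.-integrable setT (EFin \o (Num.norm \o F)) by exact: integrable_norm.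
  by rewrite -[X in (X * _)%E]fineK ?ltry//; exact: integrable_fin_num intnF.
have kE x y : k (x, y) = (F x * G y * (y <= x)%R%:R)%:E.
  rewrite /k/= indicE; have -> // : ((x, y) \in D) = (y <= x).
  by apply/idP/idP; rewrite inE.
have inner1 x : (\int[mu]_y k (x, y) =
    (((fun x => f x * \int[mu]_(y in `[s, x]) g y) \_ `[s, t]) x)%:E)%E.
  rewrite patchE; case: ifPn => [|xst]; last first.
    by rewrite integral0_eq// => y _; rewrite kE /F patchE (negbTE xst) !mul0r.
  rewrite inE/= in_itv/= => /andP[sx xt].
  have intgx : mu.-integrable `[s, x] (EFin \o g).
    apply: integrableS intg => //=.
    by apply: subset_itv => //; rewrite bnd_simp.
  rewrite EFinM /Rintegral fineK//; last exact: integrable_fin_num.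
  rewrite -integralZl// [RHS]integral_mkcond; apply: eq_integral => y _.
  rewrite kE /F /G !patchE !mem_setE/= !in_itv/= sx xt/=.
  by case: (leP s y) => sy /=; case: (leP y x) => yx /=;
    rewrite ?(le_trans yx xt) ?mulr1 ?mulr0 ?mul0r ?mulr0 ?mule0// -?EFinM.
have inner2 y : (\int[mu]_x k (x, y) =
    (((fun y => g y * \int[mu]_(x in `[y, t]) f x) \_ `[s, t]) y)%:E)%E.
  rewrite patchE; case: ifPn => [|yst]; last first.
    by rewrite integral0_eq// => x _; rewrite kE /G patchE (negbTE yst) mulr0 mul0r.
  rewrite inE/= in_itv/= => /andP[sy yt].
  have intfy : mu.-integrable `[y, t] (EFin \o f).
    apply: integrableS intf => //=.
    by apply: subset_itv => //; rewrite bnd_simp.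
  rewrite EFinM /Rintegral fineK//; last exact: integrable_fin_num.
  rewrite -integralZl// [RHS]integral_mkcond; apply: eq_integral => x _.
  rewrite kE /F /G !patchE !mem_setE/= !in_itv/= sy yt/= andbC.
  by case: (leP x t) => xt /=; case: (leP y x) => yx /=;
    rewrite ?(le_trans sy yx) ?mulr1 ?mulr0 ?mul0r ?mulr0 ?mule0// -?EFinM 1?mulrC.
have := Fubini intk; rewrite /=.
under eq_integral do rewrite inner1.
under [in RHS]eq_integral do rewrite inner2.
by move=> e; rewrite Rintegral_mkcond [RHS]Rintegral_mkcond /Rintegral e.
Qed.


(** Absolute continuity of [a] with density [f], in integrated form: the estimates are merely
    integrable, so pointwise derivatives are avoided. *)
Definition indefinite_integral s t a f :=
  mu.-integrable `[s, t] (EFin \o f) /\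
  forall u, s <= u <= t -> a u = a s + \int[mu]_(x in `[s, u]) f x.

Lemma indefinite_integral_continuous s t a f : s <= t ->
  indefinite_integral s t a f -> {within `[s, t], continuous a}.
Proof.
move=> st [intf af].
have := parameterized_integral_continuous st intf.
rewrite /parameterized_integral => cf.
apply: (@subspace_eq_continuous _ _ _
  (fun u => a s + \int[mu]_(x in `[s, u]) f x)).
  by move=> u; rewrite inE/= in_itv/= => /af.
by move=> u; apply: cvgD; [exact: cvg_cst|exact: cf].
Qed.

Lemma integrable_continuousM s t a f :
  {within `[s, t], continuous a} -> mu.-integrable `[s, t] (EFin \o f) ->
  mu.-integrable `[s, t] (EFin \o (fun x => a x * f x)).
Proof.
move=> ca intf; have := @integrableMr _ _ _ mu `[s, t] (measurable_itv _) a _ _ _ intf.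
apply.
- by apply: subspace_continuous_measurable_fun => //; exact: measurable_itv.
- have := continuous_compact ca (@segment_compact _ s t).
  by move/compact_bounded; rewrite /bounded_set /bounded_near; apply: filterS => M aM x Dx; apply: aM; exists x.
Qed.

(** The product rule for absolutely continuous functions: the double integrals arising from the two
    products cancel by [triangle_Fubini]. *)
Lemma indefinite_integralM s t a b f g : s <= t ->
  indefinite_integral s t a f -> indefinite_integral s t b g ->
  indefinite_integral s t (fun x => a x * b x) (fun x => a x * g x + b x * f x).
Proof.
move=> st af bg.
have ca := indefinite_integral_continuous st af.
have cb := indefinite_integral_continuous st bg.
case: af bg => intf af [intg bg].
have intag := integrable_continuousM ca intg.
have intbf := integrable_continuousM cb intf.
split; first exact: (integrableD _ intag intbf).
move=> u /andP[su ut].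
have sub h : mu.-integrable `[s, t] (EFin \o h) -> mu.-integrable `[s, u] (EFin \o h).
  by apply: integrableS => //; apply: subset_itv => //; rewrite bnd_simp.
move: (sub _ intf) (sub _ intg) (sub _ intag) (sub _ intbf) => {}intf {}intg {}intag {}intbf.
rewrite RintegralD//.
(* Here [a] is expanded from the left end [s], and below [b] from the right end [u], so that both
   double integrals range over the same triangle. *)
have -> : \int[mu]_(x in `[s, u]) (a x * g x) =
    \int[mu]_(x in `[s, u]) (a s * g x + g x * \int[mu]_(y in `[s, x]) f y).
  apply: eq_Rintegral => x; rewrite inE/= in_itv/= => /andP[sx xu].
  rewrite af ?sx ?(le_trans xu ut)//; ring.
have -> : \int[mu]_(x in `[s, u]) (b x * f x) =
    \int[mu]_(x in `[s, u]) (b u * f x - f x * \int[mu]_(y in `[x, u]) g y).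
  apply: eq_Rintegral => x; rewrite inE/= in_itv/= => /andP[sx xu].
  rewrite (bg u) ?su// (Rintegral_itv_split sx xu)// bg ?sx ?(le_trans xu ut)//; ring.
have intagM : mu.-integrable `[s, u]
    (EFin \o (fun x => g x * \int[mu]_(y in `[s, x]) f y)).
  have : mu.-integrable `[s, u] (EFin \o (fun x => a x * g x - a s * g x)).
    exact: (integrableB _ intag (integrableZl _ (a s) intg)).
  apply: eq_integrable => // x; rewrite inE/= in_itv/= => /andP[sx xu].
  by rewrite (af x) ?sx ?(le_trans xu ut)//; congr EFin; ring.
have intbfM : mu.-integrable `[s, u]
    (EFin \o (fun x => f x * \int[mu]_(y in `[x, u]) g y)).
  have : mu.-integrable `[s, u] (EFin \o (fun x => b u * f x - b x * f x)).
    exact: (integrableB _ (integrableZl _ (b u) intf) intbf).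
  apply: eq_integrable => // x; rewrite inE/= in_itv/= => /andP[sx xu].
  rewrite (bg u) ?su// (Rintegral_itv_split sx xu)// (bg x) ?sx ?(le_trans xu ut)//.
  by congr EFin; ring.
rewrite RintegralD//; last exact: (integrableZl _ (a s) intg).
rewrite RintegralB//; last exact: (integrableZl _ (b u) intf).
rewrite !RintegralZl// triangle_Fubini// (af u) ?su// (bg u) ?su//.
ring.
Qed.

Lemma continuous_indefinite_integral s t a f :
  {within `[s, t], continuous f} ->
  (forall x, s <= x <= t -> is_derive x 1 a (f x)) ->
  indefinite_integral s t a f.
Proof.
move=> cf da; split.
  exact: continuous_compact_integrable (@segment_compact _ s t) cf.
(* The fundamental theorem of calculus is applied on a nondegenerate interval only. *)
move=> u /andP[]; rewrite le_eqVlt => /predU1P[<- _|su ut].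
  by rewrite set_itv1 Rintegral_set1 addr0.
rewrite /Rintegral (@continuous_FTC2 _ f a)//=; last 3 first.
- apply: continuous_subspaceW cf.
  by apply: subset_itv => //; rewrite bnd_simp.
- have ca x : s <= x <= u -> {for x, continuous a}.
    move=> /andP[sx xu]; apply/differentiable_continuous/derivable1_diffP.
    by have [] := da x; rewrite ?sx ?(le_trans xu ut).
  split.
  + move=> x; rewrite in_itv/= => /andP[sx xu].
    by have [] := da x; rewrite ?(ltW sx) ?(ltW (lt_le_trans xu ut)).
  + by apply: cvg_at_right_filter; apply: ca; rewrite lexx ltW.
  + by apply: cvg_at_left_filter; apply: ca; rewrite lexx ltW.
- move=> x; rewrite in_itv/= => /andP[sx xu].
  rewrite derive1E; apply: derive_val; apply: da.
  by rewrite (ltW sx) (ltW (lt_le_trans xu ut)).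
ring.
Qed.

End indefinite_integrals.

(** * The dual Hardy inequality *)

Section hardy.
Context {R : realType}.
Notation mu := (@lebesgue_measure R).
Implicit Types (s t u e : R) (a b f g h l : R -> R).

Lemma indefinite_integral_ext s t a b f g : s <= t ->
  (forall x, s <= x <= t -> a x = b x) ->
  (forall x, s <= x <= t -> f x = g x) ->
  indefinite_integral s t a f -> indefinite_integral s t b g.
Proof.
move=> st ab fg [intf af]; split.
  apply: eq_integrable intf => // x; rewrite inE/= in_itv/= => xst.
  by rewrite fg.
move=> u /andP[su ut]; rewrite -!ab ?su ?lexx// af ?su//; congr (_ + _).
apply: eq_Rintegral => x; rewrite inE/= in_itv/= => /andP[sx xu].
by rewrite fg// sx (le_trans xu).
Qed.

Lemma indefinite_integral_inv s t : 0 < s ->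
  indefinite_integral s t (fun x => x^-1) (fun x => - (x ^- 2)).
Proof.
move=> s0; apply: continuous_indefinite_integral => [|x /andP[sx _]].
  apply: continuous_in_subspaceT => x; rewrite inE/= in_itv/= => /andP[sx _].
  apply: cvgN; apply: cvgV.
    by rewrite expf_neq0// gt_eqF// (lt_le_trans s0).
  exact: exprn_continuous.
have x0 : x != 0 by rewrite gt_eqF// (lt_le_trans s0).
have := is_deriveV x0 (is_derive_id x (1 : R)).
by rewrite /GRing.scale/= mulr1.
Qed.

(** The product rule, applied twice to [a * (a * x^-1)]. *)
Lemma indefinite_integral_sqr_div s t a f : 0 < s -> s <= t ->
  indefinite_integral s t a f ->
  indefinite_integral s t (fun x => a x ^+ 2 / x)
    (fun x => 2 * a x * f x / x - (a x / x) ^+ 2).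
Proof.
move=> s0 st af.
have := indefinite_integralM st af (indefinite_integralM st af
  (indefinite_integral_inv t s0)).
apply: indefinite_integral_ext => // x /andP[sx _]; first by ring.
have x0 : x != 0 by rewrite gt_eqF// (lt_le_trans s0).
by field.
Qed.

(** Here [f] stands for the L* estimate and [g] for the optimal one. The left integral is taken in
    the extended reals because integrability of [f ^+ 2] is part of what the bound yields. *)
Lemma sqr_integral_le_dual_hardy e a b f g : 0 < e -> e <= 1 ->
  indefinite_integral e 1 a f -> indefinite_integral e 1 b g -> a 1 = b 1 ->
  (forall x, e <= x <= 1 -> `|a x - x * f x| <= b x) ->
  mu.-integrable `[e, 1] (EFin \o (fun x => g x ^+ 2)) ->
  (\int[mu]_(x in `[e, 1%R]) (f x ^+ 2)%:E <=
   (4 * \int[mu]_(x in `[e, 1]) g x ^+ 2 + 2 * (b e ^+ 2 / e))%R%:E)%E.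
Proof.
move=> e0 e1 af bg ab1 abf intg2.
have [intDa Da] := indefinite_integral_sqr_div e0 e1 af.
have [intDb Db] := indefinite_integral_sqr_div e0 e1 bg.
pose da x := 2 * a x * f x / x - (a x / x) ^+ 2.
pose db x := 2 * b x * g x / x - (b x / x) ^+ 2.
rewrite -/da in intDa Da; rewrite -/db in intDb Db.
pose F x := (da x + 4 * g x ^+ 2) - 2 * db x.
have int1 : mu.-integrable `[e, 1] (EFin \o (fun x => da x + 4 * g x ^+ 2)).
  exact: (integrableD _ intDa (integrableZl _ 4 intg2)).
have intF : mu.-integrable `[e, 1] (EFin \o F).
  exact: (integrableB _ int1 (integrableZl _ 2 intDb)).
apply: (@le_trans _ _ (\int[mu]_(x in `[e, 1%R]) (F x)%:E)%E).
  apply: ge0_le_integral => //.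
  - by move=> x _; rewrite lee_fin sqr_ge0.
  - apply/measurable_EFinP; apply: measurable_funX.
    by case: af => /integrableP[/measurable_EFinP].
  - by case/integrableP: intF.
  - move=> x /=; rewrite in_itv/= => /andP[ex x1]; rewrite lee_fin.
    have x0 : 0 < x by exact: lt_le_trans ex.
    have abx : (a x / x - f x) ^+ 2 <= (b x / x) ^+ 2.
      have -> : a x / x - f x = (a x - x * f x) / x by field; rewrite gt_eqF.
      rewrite !expr_div_n ler_pM2r ?invr_gt0 ?exprn_gt0//.
      have abxn := abf x (introT andP (conj ex x1)).
      rewrite -[leLHS]real_normK ?num_real// lerXn2r ?nnegrE//.
      exact: le_trans abxn.
    rewrite -subr_ge0 /F /da /db.
    (* The slack of the pointwise bound is a square plus a difference of squares, which is
       nonnegative by [abx]. *)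
    have -> : 2 * a x * f x / x - (a x / x) ^+ 2 + 4 * g x ^+ 2 -
      2 * (2 * b x * g x / x - (b x / x) ^+ 2) - f x ^+ 2 =
      (b x / x) ^+ 2 - (a x / x - f x) ^+ 2 + (2 * g x - b x / x) ^+ 2 by ring.
    by rewrite addr_ge0 ?sqr_ge0// subr_ge0.
have -> : (\int[mu]_(x in `[e, 1%R]) (F x)%:E)%E = (\int[mu]_(x in `[e, 1]) F x)%:E.
  by rewrite /Rintegral fineK//; exact: integrable_fin_num intF.
rewrite lee_fin /F RintegralB//; last exact: (integrableZl _ 2 intDb).
rewrite RintegralD//; last exact: (integrableZl _ 4 intg2).
rewrite !RintegralZl//.
have := Da 1; have := Db 1; rewrite e1 lexx => /(_ isT) + /(_ isT).
rewrite ab1 !divr1.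
rewrite -/da -/db => Db1 Da1.
(* As [a 1 = b 1], the boundary terms add up to [- b 1 ^+ 2 - a e ^+ 2 / e + 2 * (b e ^+ 2 / e)];
   the two negative ones are dropped. *)
have : 0 <= a e ^+ 2 / e by rewrite divr_ge0 ?sqr_ge0// ltW.
have : 0 <= b 1 ^+ 2 by rewrite sqr_ge0.
rewrite /=; lra.
Qed.


(** * Square integrals over []0, 1]] by exhaustion from the right *)

Lemma itv_oc01_bigcup :
  `](0 : R), (1 : R)]%classic = \bigcup_n `[n.+1%:R^-1 : R, 1 : R]%classic.
Proof.
apply/seteqP; split=> x /=.
  rewrite in_itv/= => /andP[x0 x1].
  have [n nx] := ltr_add_invr x0.
  by exists n => //=; rewrite in_itv/= x1 andbT ltW// (le_lt_trans _ nx)// add0r.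
move=> [n _]/=; rewrite !in_itv/= => /andP[nx ->]; rewrite andbT.
by apply: lt_le_trans nx; rewrite invr_gt0.
Qed.

Lemma measurable_sqr_away_from0 f : integrable_away_from0 f ->
  measurable_fun `](0 : R), (1 : R)]%classic (fun x => (f x ^+ 2)%:E).
Proof.
move=> intf; rewrite itv_oc01_bigcup; apply/measurable_fun_bigcup => // n.
apply/measurable_EFinP; apply: measurable_funX.
have n01 : 0 < (n.+1%:R^-1 : R) <= 1 by rewrite invr_gt0 ltr0n invf_le1 ?ler1n.
by have /integrableP[/measurable_EFinP] := intf _ n01.
Qed.

(** Monotone convergence along the intervals [[1/(n+1), 1]]. *)
Lemma sq_integral_cvg f : integrable_away_from0 f ->
  (\int[mu]_(x in `[n.+1%:R^-1%R, 1%R]) (f x ^+ 2)%:E @[n --> \oo]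
    --> sq_integral f)%E.
Proof.
move=> intf; rewrite /sq_integral itv_oc01_bigcup.
apply: ge0_nondecreasing_set_cvg_integral.
- move=> m n mn; apply/subsetPset; apply: subset_itv; rewrite ?bnd_simp//.
  by rewrite lef_pV2 ?posrE// ler_nat.
- by move=> n; exact: measurable_itv.
- move=> n; apply: measurable_funS (measurable_sqr_away_from0 intf) => //.
  by rewrite itv_oc01_bigcup => x xn; exists n.
- by move=> n x _; rewrite lee_fin sqr_ge0.
Qed.

Lemma le_sq_integral f e : integrable_away_from0 f -> 0 < e ->
  (\int[mu]_(x in `[e, 1%R]) (f x ^+ 2)%:E <= sq_integral f)%E.
Proof.
move=> intf e0; apply: ge0_subset_integral => //.
- exact: measurable_sqr_away_from0.
- by move=> x _; rewrite lee_fin sqr_ge0.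
- by apply: subset_itv; rewrite bnd_simp.
Qed.

Lemma sq_integral_le f (C : \bar R) : integrable_away_from0 f ->
  (forall e, 0 < e <= 1 -> (\int[mu]_(x in `[e, 1%R]) (f x ^+ 2)%:E <= C)%E) ->
  (sq_integral f <= C)%E.
Proof.
move=> intf fC; have fcvg := sq_integral_cvg intf.
rewrite -(cvg_lim _ fcvg)//; apply: lime_le; first by apply/cvg_ex; exists (sq_integral f).
apply: nearW => n; apply: fC.
by rewrite invr_gt0 ltr0n invf_le1 ?ler1n.
Qed.

(* Integrate [0 <= (g - c)^2], with [c] the mean of [g]. *)
Lemma sqr_Rintegral_le s t g : s <= t ->
  mu.-integrable `[s, t] (EFin \o g) ->
  mu.-integrable `[s, t] (EFin \o (fun x => g x ^+ 2)) ->
  (\int[mu]_(x in `[s, t]) g x) ^+ 2 <= (t - s) * \int[mu]_(x in `[s, t]) g x ^+ 2.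
Proof.
rewrite le_eqVlt => /predU1P[<- _ _|st intg intg2].
  by rewrite !set_itv1 !Rintegral_set1 mulr0 expr0n.
set I := \int[mu]_(x in _) g x; set J := \int[mu]_(x in _) _ ^+ 2.
pose c := I / (t - s).
have ts0 : t - s != 0 by rewrite subr_eq0 gt_eqF.
have intc := integrable_itv_cst s t (c ^+ 2).
have int2 : mu.-integrable `[s, t] (EFin \o (fun x => g x ^+ 2 - 2 * c * g x)).
  exact: (integrableB _ intg2 (integrableZl _ (2 * c) intg)).
have : 0 <= \int[mu]_(x in `[s, t]) ((g x ^+ 2 - 2 * c * g x) + c ^+ 2).
  apply: Rintegral_ge0 => x _.
  have -> : g x ^+ 2 - 2 * c * g x + c ^+ 2 = (g x - c) ^+ 2 by ring.
  exact: sqr_ge0.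
rewrite RintegralD// RintegralB//; last exact: (integrableZl _ (2 * c) intg).
rewrite RintegralZl// (Rintegral_itv_cst _ (ltW st)) -/I -/J => h.
have : 0 <= (t - s) * (J - 2 * c * I + c ^+ 2 * (t - s)).
  by rewrite mulr_ge0// subr_ge0 ltW.
suff -> : (t - s) * (J - 2 * c * I + c ^+ 2 * (t - s)) = (t - s) * J - I ^+ 2.
  by rewrite subr_ge0.
by rewrite /c; field.
Qed.

End hardy.

(** * The upper bound *)

Section lower_bound_function.
Context {R : realType} {V : Type} (S : monotone_sampling_scheme R V) (f : V -> R).
Hypothesis f0 : forall z, 0 <= f z.
Variable v : V.
Local Notation h := (lower_bound_fun S f v).

Lemma lower_bound_funE u : 0 < u -> h u = inf (f @` S u v).
Proof. by rewrite /lower_bound_fun => ->. Qed.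

Let has_lbound_image u : has_lbound (f @` S u v).
Proof. by exists 0 => _ [z _ <-]. Qed.

Let image_Sstar_neq0 u : 0 < u <= 1 -> f @` S u v !=set0.
Proof. by move=> u01; exists (f v); exists v => //; exact: Sstar_refl. Qed.

Lemma lower_bound_fun_ge0 u : 0 < u <= 1 -> 0 <= h u.
Proof.
move=> u01; rewrite lower_bound_funE; last by case/andP: u01.
by apply: lb_le_inf; [exact: image_Sstar_neq0|move=> _ [z _ <-]].
Qed.

Lemma lower_bound_fun_nonincreasing u u' : 0 < u -> u <= u' -> u' <= 1 ->
  h u' <= h u.
Proof.
move=> u0 uu' u'1; have u'0 := lt_le_trans u0 uu'.
rewrite !lower_bound_funE//; apply: lb_le_inf.
  by apply: image_Sstar_neq0; rewrite u0 (le_trans uu').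
move=> _ [z Sz <-]; apply: ge_inf; first exact: has_lbound_image.
by exists z => //; exact: Sstar_mono Sz.
Qed.

(** On []0, 1[] the function [h] is nonincreasing, and bounded above by [f v] because [v] is always
    consistent with itself. Hence the [lim] that defines [h 0] is a genuine limit. *)
Lemma lower_bound_fun_cvg0 : h x @[x --> 0^'+] --> h 0.
Proof.
have ndh : {in `]0, 1[ &, {homo h : m n /~ n <= m}}.
  move=> x y; rewrite !in_itv/= => /andP[x0 _] /andP[_ y1] xy.
  by apply: lower_bound_fun_nonincreasing => //; exact: ltW.
have hub : has_ubound (h @` `]0, 1[).
  exists (f v) => _ [x /= + <-]; rewrite in_itv/= => /andP[x0 x1].
  rewrite lower_bound_funE//; apply: ge_inf; first exact: has_lbound_image.
  by exists v => //; apply: Sstar_refl; rewrite x0 ltW.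
have h01 : (BRight (0 : R) < BLeft 1)%O by rewrite bnd_simp.
have hcvg := nonincreasing_at_right_cvgr h01 ndh hub.
have hE : \forall x \near (0 : R)^'+, h x = inf (f @` S x v).
  by near=> x; rewrite lower_bound_funE.
have : inf (f @` S x v) @[x --> 0^'+] --> sup (h @` `]0, 1[).
  by apply: cvg_trans hcvg; apply: near_eq_cvg; by apply: filterS hE => x /= ->.
move=> hcvg'.
have -> : h 0 = sup (h @` `]0, 1[).
  by rewrite /lower_bound_fun ltxx; exact: (cvg_lim _ hcvg').
exact: hcvg.
Unshelve. all: by end_near. Qed.

Lemma lower_bound_fun_le0 u : 0 <= u <= 1 -> h u <= h 0.
Proof.
move=> /andP[]; rewrite le_eqVlt => /predU1P[<-//|u0 u1].
apply: (cvgr_to_ge lower_bound_fun_cvg0); near=> x.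
apply: lower_bound_fun_nonincreasing => //.
near: x; exact: nbhs_right_le.
Unshelve. all: by end_near. Qed.

End lower_bound_function.

(** * Properties of the optimal estimate and 4-competitiveness *)

Section v_optimal.
Context {R : realType} {V : Type} (S : monotone_sampling_scheme R V) (f : V -> R).
Hypothesis f0 : forall z, 0 <= f z.
Variables (v : V) (g : R -> R).
Hypothesis gopt : is_v_optimal S f v g.
Notation mu := (@lebesgue_measure R).
Local Notation h := (lower_bound_fun S f v).
Local Notation G := (fun u => \int[mu]_(x in `[u, 1]) g x).

(** The constant is free: [c = h 0] yields the functions [a] and [b] of the upper bound without any
    integral reaching down to 0, and [c = 0] serves for continuity of the tail. *)
Lemma tail_indefinite_integral (k : R -> R) (c e : R) :
  integrable_away_from0 k -> 0 < e -> e <= 1 ->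
  indefinite_integral e 1 (fun u => c - \int[mu]_(x in `[u, 1]) k x) k.
Proof.
move=> intk e0 e1; have intk1 := intk e (introT andP (conj e0 e1)).
split=> // u /andP[eu u1]; rewrite (Rintegral_itv_split eu u1)//; ring.
Qed.

Lemma v_optimal_ge0 u : 0 < u <= 1 -> 0 <= g u.
Proof. by case: gopt => + _ _; exact. Qed.

Lemma v_optimal_integrable : integrable_away_from0 g.
Proof. by case: gopt. Qed.

(** This and [v_optimal_ge] are the two halves of the infimum equation, cleared of denominators and
    moved to the reals. *)
Lemma v_optimal_le u eta : 0 <= eta -> eta < u -> u <= 1 ->
  g u * (u - eta) <= h eta - G u.
Proof.
move=> eta0 etau u1; have u0 := le_lt_trans eta0 etau.
have [_ _ /(_ u)] := gopt; rewrite u0 u1 => /(_ isT) gE.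
rewrite -ler_pdivlMr ?subr_gt0// -lee_fin gE.
by apply: ereal_inf_lbound; exists eta => //=; rewrite in_itv/= eta0.
Qed.

Lemma v_optimal_ge u c : 0 < u <= 1 ->
  (forall eta, 0 <= eta < u -> c * (u - eta) <= h eta - G u) -> c <= g u.
Proof.
move=> u01 hc; have [_ _ /(_ _ u01) gE] := gopt.
rewrite -lee_fin gE; apply: le_ereal_inf_tmp => _ [eta /= + <-].
rewrite in_itv/= => etau; rewrite lee_fin ler_pdivlMr ?hc//.
by rewrite subr_gt0; case/andP: etau.
Qed.

(** For [u > eta], [v_optimal_le] and [g >= 0] give [G u <= h eta]; then [u] decreases to [eta] by
    continuity of the tail. *)
Lemma v_optimal_tail_le eta : 0 < eta <= 1 -> G eta <= h eta.
Proof.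
move=> /andP[eta0]; rewrite le_eqVlt => /predU1P[->|eta1].
  by rewrite set_itv1 Rintegral_set1 lower_bound_fun_ge0// ltr01 lexx.
have := indefinite_integral_continuous (ltW eta1)
  (tail_indefinite_integral 0 v_optimal_integrable eta0 (ltW eta1)).
move=> /(continuous_within_itvP _ eta1)[_ NGcvg _].
have Gcvg : G x @[x --> eta^'+] --> G eta.
  have GE u : G u = - (0 - G u) by ring.
  by rewrite [X in _ --> X]GE; under eq_fun do rewrite GE; exact: cvgN.
apply: (cvgr_to_le Gcvg); near=> u.
have etau : eta < u by [].
have u1 : u <= 1 by near: u; exact: nbhs_right_le.
rewrite -subr_ge0; apply: le_trans (v_optimal_le (ltW eta0) etau u1).
rewrite mulr_ge0//; last by rewrite subr_ge0 ltW.
by apply: v_optimal_ge0; rewrite (lt_trans eta0 etau).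
Unshelve. all: by end_near. Qed.

Hypothesis gsq : (sq_integral g < +oo)%E.

Lemma v_optimal_sqr_integrable e : 0 < e <= 1 ->
  mu.-integrable `[e, 1] (EFin \o (fun x => g x ^+ 2)).
Proof.
move=> e01; apply/integrableP; split.
  apply/measurable_EFinP; apply: measurable_funX.
  by have /integrableP[/measurable_EFinP] := v_optimal_integrable e01.
under eq_integral => x _ do rewrite /= ger0_norm ?sqr_ge0//.
apply: le_lt_trans gsq; apply: le_sq_integral; first exact: v_optimal_integrable.
by case/andP: e01.
Qed.

Let I := fine (sq_integral g).

Let sq_integral_ge0 : (0 <= sq_integral g)%E.
Proof. by apply: integral_ge0 => x _; rewrite lee_fin sqr_ge0. Qed.

Let sq_integralE : sq_integral g = I%:E.
Proof. by rewrite fineK// ge0_fin_numE. Qed.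

Let I0 : 0 <= I.
Proof. exact: fine_ge0. Qed.

Lemma Rintegral_sqr_le_sq_integral e : 0 < e <= 1 ->
  \int[mu]_(x in `[e, 1]) g x ^+ 2 <= fine (sq_integral g).
Proof.
move=> e01; rewrite -lee_fin -/I -sq_integralE /Rintegral fineK.
  apply: le_sq_integral; first exact: v_optimal_integrable.
  by case/andP: e01.
exact: integrable_fin_num (v_optimal_sqr_integrable e01).
Qed.

(* Otherwise [g] would dominate a multiple of [1/u] near 0 and would not be square integrable. *)
Lemma v_optimal_tail_approx (c e : R) : 0 < c -> 0 < e <= 1 ->
  exists2 d, 0 < d < e & h 0 - G d < c.
Proof.
move=> c0 /andP[e0 e1]; apply: contrapT => nd.
have {}nd d : 0 < d < e -> G d <= h 0 - c.
  move=> de; rewrite lerBrDr addrC -lerBrDr leNgt; apply/negP => dc.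
  by apply: nd; exists d.
have hc : h 0 - c / 2 < h 0 by rewrite ltrBlDr ltrDl divr_gt0.
(* Below [d] the function [h] loses at most [c / 2], whereas the tail [G] stays [c] below [h 0]; so
   [h eta - G u] is at least [c / 2] there. *)
have [d /andP[d0 de] hd] : exists2 d, 0 < d < e &
    forall eta, 0 <= eta < d -> h 0 - c / 2 <= h eta.
  have [r /= r0 hr] := cvgr_ge _ (@lower_bound_fun_cvg0 _ _ S f f0 v) _ hc.
  exists (Num.min r e / 2).
    rewrite divr_gt0 ?lt_min ?r0 ?e0//=.
    by rewrite ltr_pdivrMr// (le_lt_trans (_ : _ <= e)) ?ge_min ?lexx ?orbT// ltr_pMr// ltr1n.
  move=> eta /andP[]; rewrite le_eqVlt => /predU1P[<- _|eta0 etad].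
    exact: ltW.
  apply: hr => //=; rewrite sub0r normrN gtr0_norm//.
  rewrite (lt_le_trans etad)// ler_pdivrMr// (le_trans (_ : _ <= r)) ?ge_min ?lexx//.
  by rewrite ler_peMr ?ler1n// ltW.
have glb u : 0 < u < d -> c / 2 / u <= g u.
  move=> /andP[u0 ud]; have u1 : u <= 1 by rewrite (le_trans (ltW ud))// (le_trans (ltW de)).
  apply: v_optimal_ge; first by rewrite u0.
  move=> eta /andP[eta0 etau].
  have := hd eta; rewrite eta0 (lt_trans etau ud) => /(_ isT) heta.
  have := nd u; rewrite u0 (lt_trans ud de) => /(_ isT) Gu.
  apply: (@le_trans _ _ (c / 2)); last by lra.
  rewrite -(mulrA (c / 2)) ler_piMr//; first by rewrite divr_ge0// ltW.
  by rewrite mulrC ler_pdivrMr// mul1r lerBlDr lerDl.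
pose u := Num.min (d / 2) (c ^+ 2 / (8 * (I + 1))).
have I1 : 0 < I + 1 by rewrite ltr_wpDl.
have u0 : 0 < u by rewrite /u lt_min !divr_gt0 ?exprn_gt0// mulr_gt0.
have ud : u < d.
  by rewrite (le_lt_trans (_ : _ <= d / 2)) ?ge_min ?lexx// ltr_pdivrMr// ltr_pMr// ltr1n.
have u1 : u <= 1 by rewrite (le_trans (ltW ud))// (le_trans (ltW de)).
have u20 : 0 < u / 2 by rewrite divr_gt0.
have u2u : u / 2 <= u by rewrite ler_pdivrMr// ler_peMr ?ler1n// ltW.
(* On [[u / 2, u]] the bound [glb] gives [g >= c / (2 * u)], so this interval alone contributes
   [c ^+ 2 / (8 * u)]; the choice of [u] makes that exceed [I]. *)
have u21 : 0 < u / 2 <= 1 by rewrite u20 (le_trans u2u).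
have intg2 := v_optimal_sqr_integrable u21.
have := Rintegral_sqr_le_sq_integral u21; rewrite -/I; apply/negP; rewrite -ltNge.
rewrite (Rintegral_itv_split u2u u1)//.
have r0 : 0 <= \int[mu]_(x in `[u, 1]) g x ^+ 2 by apply: Rintegral_ge0 => x _; exact: sqr_ge0.
have : (c / 2 / u) ^+ 2 * (u / 2) <= \int[mu]_(x in `[u / 2, u]) g x ^+ 2.
  have -> : (c / 2 / u) ^+ 2 * (u / 2) = \int[mu]_(x in `[u / 2, u]) ((c / 2 / u) ^+ 2).
    by rewrite Rintegral_itv_cst//; field; rewrite gt_eqF.
  apply: le_Rintegral => //.
  - exact: integrable_itv_cst.
  - by apply: integrableS intg2 => //; apply: subset_itv => //; rewrite bnd_simp.
  - move=> x /=; rewrite in_itv/= => /andP[u2x xu].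
    have x0 : 0 < x by exact: lt_le_trans u2x.
    have xg := glb x (introT andP (conj x0 (le_lt_trans xu ud))).
    have cu0 : 0 <= c / 2 / u by rewrite !divr_ge0// ltW.
    have cxg : c / 2 / u <= g x.
      by apply: le_trans xg; rewrite ler_pM2l ?divr_gt0// lef_pV2// posrE.
    by rewrite lerXn2r ?nnegrE// (le_trans cu0).
rewrite (_ : _ * (u / 2) = c ^+ 2 / (8 * u)); last by field; rewrite gt_eqF.
suff Ilt : I < c ^+ 2 / (8 * u).
  by move=> cA; rewrite (lt_le_trans Ilt)// (le_trans cA)// lerDl.
rewrite ltr_pdivlMr ?mulr_gt0// (lt_le_trans (_ : _ < (I + 1) * (8 * u)))//.
  by rewrite ltr_pM2r ?ltrDl// mulr_gt0.
rewrite (_ : (I + 1) * (8 * u) = u * (8 * (I + 1))); last by ring.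
rewrite -ler_pdivlMr ?mulr_gt0//.
by rewrite /u ge_min lexx orbT.
Qed.

(* [h 0 - G e] is the integral of [g] over ]0, e], so this is Cauchy-Schwarz. *)
Lemma v_optimal_sqr_head_le e : 0 < e <= 1 ->
  (h 0 - G e) ^+ 2 / e <= fine (sq_integral g) - \int[mu]_(x in `[e, 1]) g x ^+ 2.
Proof.
move=> e01; have /andP[e0 e1] := e01.
set E := \int[mu]_(x in _) _ ^+ 2.
have EI : E <= I := Rintegral_sqr_le_sq_integral e01.
rewrite ler_pdivrMr// mulrC.
have head_ge0 : 0 <= h 0 - G e.
  rewrite subr_ge0 (le_trans (v_optimal_tail_le e01))//.
  by apply: lower_bound_fun_le0 => //; rewrite ltW.
have K0 : 0 <= e * (I - E) by rewrite mulr_ge0 ?subr_ge0// ltW.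
(* After passing to square roots an additive error [c] can be absorbed: the head splits at [d] into
   a part below [c] and the integral over [[d, e]], to which Cauchy-Schwarz applies. *)
rewrite -[leRHS]sqr_sqrtr// lerXn2r ?nnegrE ?sqrtr_ge0//.
apply/ler_addgt0Pr => c c0.
have [d /andP[d0 de] dc] := v_optimal_tail_approx c0 e01.
have d01 : 0 < d <= 1 by rewrite d0 (le_trans (ltW de)).
have intg := v_optimal_integrable d01.
have intg2 := v_optimal_sqr_integrable d01.
have sub k : mu.-integrable `[d, 1] (EFin \o k) -> mu.-integrable `[d, e] (EFin \o k).
  by apply: integrableS => //; apply: subset_itv => //; rewrite bnd_simp.
have Gde := Rintegral_itv_split (ltW de) e1 intg.
suff : \int[mu]_(x in `[d, e]) g x <= Num.sqrt (e * (I - E)) by move: dc; rewrite Gde; lra.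
apply: le_trans (ler_norm _) _; rewrite -sqrtr_sqr ler_wsqrtr//.
apply: le_trans (sqr_Rintegral_le (ltW de) (sub _ intg) (sub _ intg2)) _.
have := Rintegral_sqr_le_sq_integral d01.
rewrite (Rintegral_itv_split (ltW de) e1 intg2) -/I -/E => h1.
have J0 : 0 <= \int[mu]_(x in `[d, e]) g x ^+ 2 by apply: Rintegral_ge0 => x _; exact: sqr_ge0.
apply: ler_pM => //; first by rewrite subr_ge0 ltW.
- by rewrite lerBlDr lerDl ltW.
- by rewrite lerBrDr.
Qed.

(** The dual Hardy bound is applied on each [[e, 1]], and its boundary term is controlled by the
    square integral missing from [[e, 1]]. *)
Lemma Lstar_4competitive fL : is_Lstar S f fL ->
  (sq_integral (fL ^~ v) <= 4%:E * sq_integral g)%E.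
Proof.
move=> /(_ v)[intl lE]; apply: sq_integral_le => // e /andP[e0 e1].
have e01 : 0 < e <= 1 by rewrite e0.
have A := tail_indefinite_integral (h 0) intl e0 e1.
have B := tail_indefinite_integral (h 0) v_optimal_integrable e0 e1.
apply: le_trans (sqr_integral_le_dual_hardy e0 e1 A B _ _ (v_optimal_sqr_integrable e01)) _.
- by rewrite set_itv1 !Rintegral_set1.
- move=> x /andP[ex x1]; have x0 := lt_le_trans e0 ex.
  have x01 : 0 < x <= 1 by rewrite x0.
  rewrite lE// mulrA divff ?gt_eqF// mul1r.
  (* The L* equation cancels the tail integral of the L* estimate. *)
  rewrite (_ : _ - _ - _ = h 0 - h x); last by ring.
  have hx0 : h x <= h 0 by apply: lower_bound_fun_le0 => //; rewrite ltW.
  by rewrite ger0_norm ?subr_ge0// lerB// v_optimal_tail_le.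
(* With [E] the integral of [g ^+ 2] over [[e, 1]], the bound is at most [4 * E + 2 * (I - E)], and
   [E <= I]. *)
- rewrite sq_integralE -EFinM lee_fin.
  have := v_optimal_sqr_head_le e01; rewrite -/I.
  have := Rintegral_sqr_le_sq_integral e01; rewrite -/I.
  lra.
Qed.

End v_optimal.

(** * Tightness *)

Lemma continuous_integrable_away_from0 {R : realType} (k : R -> R) :
  (forall u, 0 < u <= 1 -> {for u, continuous k}) -> integrable_away_from0 k.
Proof.
move=> kc u /andP[u0 _]; apply: continuous_compact_integrable.
  exact: segment_compact.
apply: continuous_in_subspaceT => x; rewrite inE/= in_itv/= => /andP[ux x1].
by apply: kc; rewrite (lt_le_trans u0 ux).
Qed.

(** * A sampling scheme realizing a prescribed optimal estimate *)

Section threshold_sampling.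
Context {R : realType}.
Notation mu := (@lebesgue_measure R).

Definition unit_interval := {z : R | 0 <= z <= 1}.

(* A datum [z] is revealed exactly by the seeds [u <= z]; all data below the seed are indistinguishable. *)
Definition threshold_set (u : R) (z : unit_interval) : set unit_interval :=
  [set y | y = z \/ (val y < u /\ val z < u)].

Lemma threshold_set_outcome u v z : 0 < u <= 1 -> threshold_set u v z ->
  outcome threshold_set u z = outcome threshold_set u v.
Proof.
move=> _ [->//|[zu vu]]; congr (_, _).
by apply/seteqP; split=> y /= [->|[yu _]]; right.
Qed.

Lemma threshold_set_mono u u' v : 0 < u -> u <= u' -> u' <= 1 ->
  threshold_set u v `<=` threshold_set u' v.
Proof.
move=> _ uu' _ y [->|[yu vu]]; first by left.
by right; split; exact: lt_le_trans uu'.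
Qed.

Lemma threshold_set_open rho v z : 0 < rho <= 1 -> threshold_set rho v z ->
  exists2 eps : R, 0 < eps &
    forall x, rho - eps < x -> 0 < x <= 1 -> threshold_set x v z.
Proof.
move=> _ [->|[zr vr]]; first by exists 1 => // x _ _; left.
exists (rho - Num.max (val z) (val v)); first by rewrite subr_gt0 gt_max zr vr.
by move=> x; rewrite subKr gt_max => /andP[zx vx] _; right.
Qed.

Definition threshold_scheme : monotone_sampling_scheme R unit_interval :=
  @MonotoneSampling R unit_interval threshold_set (fun u v _ => or_introl erefl)
    threshold_set_mono threshold_set_outcome threshold_set_open.

(** At the datum 0, [g] is to be the optimal estimate, [l] the L* estimate and [h] the lower bound
    function at positive seeds. The number [h 0] is the value of [f] at that datum; it only has to
    dominate [h], since the lower bound function at seed 0 is a limit. *)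
Variables (g l h : R -> R).
Hypothesis g0 : forall u, 0 < u <= 1 -> 0 <= g u.
Hypothesis g_noninc : forall u u', 0 < u -> u <= u' -> u' <= 1 -> g u' <= g u.
Hypothesis g_cont : forall u, 0 < u <= 1 -> {for u, continuous g}.
Hypothesis l_cont : forall u, 0 < u <= 1 -> {for u, continuous l}.
Hypothesis hE : forall u, 0 < u <= 1 -> h u = \int[mu]_(x in `[u, 1]) g x.
Hypothesis h_le0 : forall u, 0 < u <= 1 -> h u <= h 0.
Hypothesis lE : forall u, 0 < u <= 1 ->
  u * l u = h u - \int[mu]_(x in `[u, 1]) l x.

Let intg : integrable_away_from0 g.
Proof. exact: continuous_integrable_away_from0. Qed.

(** The mean of the nonincreasing [g] over [[x, u]] lies between its end values. *)
Let h_sub x u : 0 < x -> x <= u -> u <= 1 ->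
  (u - x) * g u <= h x - h u <= (u - x) * g x.
Proof.
move=> x0 xu u1; have u0 := lt_le_trans x0 xu.
have x1 := le_trans xu u1.
have intx : mu.-integrable `[x, 1] (EFin \o g) by apply: intg; rewrite x0.
have intxu : mu.-integrable `[x, u] (EFin \o g).
  by apply: integrableS intx => //; apply: subset_itv => //; rewrite bnd_simp.
rewrite !hE ?x0 ?u0// (Rintegral_itv_split xu u1)// addrK.
rewrite ![(u - x) * _]mulrC -!(Rintegral_itv_cst _ xu).
have intc c := integrable_itv_cst x u c.
apply/andP; split; apply: le_Rintegral => // y /=;
  rewrite in_itv/= => /andP[xy yu]; apply: g_noninc => //.
- exact: lt_le_trans xy.
- exact: le_trans yu u1.
Qed.

Let h_noninc x u : 0 <= x -> x <= u -> u <= 1 -> h u <= h x.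
Proof.
rewrite le_eqVlt => /predU1P[<-|x0 xu u1].
  rewrite le_eqVlt => /predU1P[<-//|u0 u1]; by apply: h_le0; rewrite u0.
have /andP[hx _] := h_sub x0 xu u1.
rewrite -subr_ge0; apply: le_trans hx.
by rewrite mulr_ge0 ?subr_ge0// g0// (lt_le_trans x0).
Qed.

Let f (z : unit_interval) := h (val z).

Let h1 : h 1 = 0.
Proof. by rewrite hE ?ltr01 ?lexx// set_itv1 Rintegral_set1. Qed.

Let f0 z : 0 <= f z.
Proof. by have /andP[z0 z1] := valP z; rewrite -h1; exact: h_noninc. Qed.

(** A datum [v >= u] is revealed, which gives [h v]. Otherwise the consistent data fill [[0, u[],
    where the infimum of the nonincreasing [h] is [h u] by left continuity. *)
Lemma threshold_lower_bound_fun u v : 0 < u <= 1 ->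
  lower_bound_fun threshold_scheme f v u = h (Num.max u (val v)).
Proof.
move=> u01; have /andP[u0 u1] := u01; rewrite lower_bound_funE//.
have flb : has_lbound (f @` threshold_scheme u v) by exists 0 => _ [z _ <-].
have fv : (f @` threshold_scheme u v) (f v) by exists v => //; left.
have /andP[v0 v1] := valP v.
apply/eqP; rewrite eq_le; apply/andP; split; last first.
  apply: lb_le_inf; first by exists (f v).
  move=> _ [z [->|[zu vu]] <-]; have /andP[z0 z1] := valP z.
    by apply: h_noninc; rewrite // ?le_max ?lexx ?orbT// ge_max u1.
  by rewrite max_l ?(ltW vu)//; apply: h_noninc => //; exact: ltW.
have [uv|vu] := leP u (val v).
  by apply: ge_inf => //; exists v => //; left.
apply/ler_addgt0Pr => e e0.
have u20 : 0 < u / 2 by rewrite divr_gt0.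
have u2u : u / 2 < u by rewrite ltr_pdivrMr// ltr_pMr// ltr1n.
have gu20 : 0 <= g (u / 2) by apply: g0; rewrite u20 (le_trans (ltW u2u)).
have gu21 : 0 < g (u / 2) + 1 by rewrite ltr_wpDl.
(* A consistent datum with [h z <= h u + e]: staying above [u / 2] bounds [g z] by [g (u / 2)], and
   the added 1 keeps the denominator positive. *)
pose z := Num.max (u / 2) (u - e / (g (u / 2) + 1)).
have u2z : u / 2 <= z by rewrite le_max lexx.
have zu : z < u by rewrite gt_max u2u/= ltrBlDr ltrDl divr_gt0.
have z0 : 0 < z by exact: lt_le_trans u2z.
have z01 : 0 <= z <= 1 by rewrite !ltW// (lt_le_trans zu).
apply: (@le_trans _ _ (h z)).
  apply: ge_inf => //; exists (exist _ z z01) => //.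
  by right.
have /andP[_] := h_sub z0 (ltW zu) u1.
rewrite lerBlDl => /le_trans; apply; rewrite lerD2l.
apply: (@le_trans _ _ ((u - z) * g (u / 2))).
  rewrite ler_wpM2l ?subr_ge0 ?(ltW zu)//; apply: g_noninc => //.
  exact: ltW (lt_le_trans zu u1).
apply: (@le_trans _ _ (e / (g (u / 2) + 1) * g (u / 2))).
  by rewrite ler_wpM2r// lerBlDl -lerBlDr le_max lexx orbT.
rewrite mulrAC ler_pdivrMr// ler_wpM2l// ?lerDl//.
exact: ltW.
Qed.

Let zero_datum : unit_interval := exist _ 0 (introT andP (conj (lexx 0) ler01)).

(** For [eta > 0] the quotient is the mean of [g] over [[eta, u]]: it is at least [g u], and
    approaches [g u] as [eta] increases to [u]. *)
Lemma threshold_v_optimal : is_v_optimal threshold_scheme f zero_datum g.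
Proof.
split => // u u01; have /andP[u0 u1] := u01.
set L := lower_bound_fun _ _ _.
have LE x : 0 < x <= 1 -> L x = h x.
  move=> x01; rewrite /L threshold_lower_bound_fun//= max_l//.
  by apply: ltW; case/andP: x01.
rewrite -hE//; apply/eqP; rewrite eq_le; apply/andP; split.
  apply: le_ereal_inf_tmp => _ [eta /= + <-]; rewrite in_itv/= => /andP[eta0 etau].
  rewrite lee_fin ler_pdivlMr ?subr_gt0// mulrC.
  move: eta0; rewrite le_eqVlt => /predU1P[eta0|eta0]; last first.
    have eta1 : eta <= 1 by rewrite ltW// (lt_le_trans etau).
    rewrite LE ?eta0//.
    by have /andP[] := h_sub eta0 (ltW etau) u1.
  rewrite -eta0 subr0.
  (* The case [eta = 0] is reached from positive [x], using [h x <= L 0]; the loss [x * g u] is made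
     at most [e]. *)
  suff : forall x, 0 < x < u -> (u - x) * g u <= L 0 - h u.
    move=> hx; apply/ler_addgt0Pr => e e0.
    pose x := Num.min (u / 2) (e / (g u + 1)).
    have gu0 : 0 <= g u by exact: g0.
    have gu1 : 0 < g u + 1 by rewrite ltr_wpDl.
    have x0 : 0 < x by rewrite lt_min !divr_gt0.
    have xu : x < u by rewrite gt_min ltr_pdivrMr// ltr_pMr// ltr1n.
    have := hx x; rewrite x0 xu => /(_ isT) hxu.
    have xe : x * g u <= e.
      apply: (@le_trans _ _ (x * (g u + 1))); first by rewrite ler_pM2l// lerDl.
      by rewrite -ler_pdivlMr// ge_min lexx orbT.
    lra.
  move=> x /andP[x0 xu]; have /andP[+ _] := h_sub x0 (ltW xu) u1.
  move=> /le_trans; apply; rewrite lerB// -LE ?x0 ?(le_trans (ltW xu))//.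
  by apply: lower_bound_fun_le0 => //; rewrite ltW// (le_trans (ltW xu)).
apply/lee_addgt0Pr => e e0; rewrite -EFinD.
have ge : g u < g u + e by rewrite ltrDl.
have gcvg : g x @[x --> u^'-] --> g u by apply: cvg_at_left_filter; exact: g_cont.
near u^'- => eta.
have eta0 : 0 < eta by near: eta; exact: nbhs_left_gt.
have etau : eta < u by [].
have eta1 : eta <= 1 by rewrite ltW// (lt_le_trans etau).
apply: (@le_trans _ _ ((h eta - h u) / (u - eta))%:E).
  apply: ereal_inf_lbound; exists eta; first by rewrite /= in_itv/= ltW.
  by rewrite LE// eta0.
rewrite lee_fin ler_pdivrMr ?subr_gt0// mulrC.
have /andP[_ hge] := h_sub eta0 (ltW etau) u1.
apply: (le_trans hge); rewrite ler_wpM2l ?subr_ge0 ?(ltW etau)//.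
near: eta; exact: (cvgr_le _ gcvg).
Unshelve. all: by end_near. Qed.

(** The L* equation is required at every datum. For seeds up to [v] the lower bound function is
    constantly [h v], and the estimate is frozen at [l v]. *)
Lemma threshold_Lstar :
  is_Lstar threshold_scheme f (fun rho v => l (Num.max rho (val v))).
Proof.
move=> v; have /andP[v0 v1] := valP v.
have intlv : integrable_away_from0 (fun rho => l (Num.max rho (val v))).
  apply: continuous_integrable_away_from0 => x /andP[x0 x1].
  apply: (@continuous_comp _ _ _ (Num.max ^~ (val v)) l).
    by apply: continuous_max; [exact: cvg_id|exact: cvg_cst].
  by apply: l_cont; rewrite lt_max x0 ge_max x1.
split=> // rho rho01; have /andP[rho0 rho1] := rho01.
rewrite threshold_lower_bound_fun//.
apply: (mulfI (lt0r_neq0 rho0)); rewrite mulrA divff ?gt_eqF// mul1r.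
have [rv|vr] := leP rho (val v); last first.
  rewrite lE//; congr (_ - _); apply: eq_Rintegral => x.
  by rewrite inE/= in_itv/= => /andP[rx _]; rewrite max_l// (le_trans (ltW vr)).
have v01 : 0 < val v <= 1 by rewrite (lt_le_trans rho0).
rewrite (Rintegral_itv_split rv v1); last exact: intlv.
rewrite (_ : \int[mu]_(x in `[rho, val v]) _ = (val v - rho) * l (val v)); last first.
  rewrite mulrC -(Rintegral_itv_cst _ rv); apply: eq_Rintegral => x.
  by rewrite inE/= in_itv/= => /andP[_ xv]; rewrite max_r.
rewrite (_ : \int[mu]_(x in `[val v, 1]) _ = \int[mu]_(x in `[val v, 1]) l x); last first.
  apply: eq_Rintegral => x.
  by rewrite inE/= in_itv/= => /andP[vx _]; rewrite max_l.
by have := lE v01; lra.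
Qed.

Lemma threshold_ratio : (sq_integral g < +oo)%E ->
  exists (V : Type) (S : monotone_sampling_scheme R V) (f : V -> R)
         (v : V) (fv : R -> R) (fL : R -> V -> R),
    [/\ forall z, 0 <= f z,
        is_v_optimal S f v fv,
        is_Lstar S f fL,
        (sq_integral fv < +oo)%E &
        (sq_integral l / sq_integral g = sq_integral (fL ^~ v) / sq_integral fv)%E].
Proof.
move=> gsq; exists unit_interval, threshold_scheme, f, zero_datum, g,
  (fun rho v => l (Num.max rho (val v))).
split=> //; [exact: threshold_v_optimal|exact: threshold_Lstar|].
congr (_ / _)%E; apply: eq_integral => x; rewrite inE/= in_itv/= => /andP[x0 _].
by rewrite max_l// ltW.
Qed.

End threshold_sampling.

(** Evaluates an improper square integral as the limit at 0 of its closed form [phi] on [[u, 1]]. *)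
Lemma sq_integral_eq {R : realType} (k phi : R -> R) (L : R) :
  (forall u, 0 < u <= 1 -> {for u, continuous k}) ->
  (forall u, 0 < u <= 1 ->
    \int[@lebesgue_measure R]_(x in `[u, 1]) k x ^+ 2 = phi u) ->
  phi x @[x --> 0^'+] --> L -> sq_integral k = L%:E.
Proof.
move=> kc kE phiL.
have intk2 : integrable_away_from0 (fun x => k x ^+ 2).
  apply: continuous_integrable_away_from0 => u u01.
  exact: (@continuous_comp _ _ _ k (fun y => y ^+ 2) _ (kc _ u01) (@exprn_continuous _ 2 _)).
have kcvg := sq_integral_cvg (continuous_integrable_away_from0 kc).
rewrite -(cvg_lim _ kcvg)//; apply: cvg_lim => //.
have n01 n : 0 < (n.+1%:R^-1 : R) <= 1 by rewrite invr_gt0 ltr0n invf_le1 ?ler1n.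
rewrite (_ : (fun n => _) = (fun n => (phi n.+1%:R^-1)%:E)); last first.
  apply/funext => n; rewrite -kE// /Rintegral fineK//.
  exact: integrable_fin_num (intk2 _ (n01 n)).
apply: cvg_EFin; first by apply: nearW.
apply: (cvg_at_rightP phi 0 L).1 => //; split.
  by move=> n; case/andP: (n01 n).
exact: cvg_harmonic.
Qed.

(** * The power functions and their ratio *)

Section power_functions.
Context {R : realType}.
Notation mu := (@lebesgue_measure R).
Implicit Types p r u x : R.

Lemma powR_continuous_pos r x : 0 < x -> {for x, continuous (@powR R ^~ r)}.
Proof.
move=> x0; apply/differentiable_continuous/derivable1_diffP.
by apply: derivable_powR; rewrite in_itv/= x0.
Qed.

Lemma powR_integrable_away_from0 r : integrable_away_from0 (fun x => x `^ r).
Proof.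
apply: continuous_integrable_away_from0 => u /andP[u0 _].
exact: powR_continuous_pos.
Qed.

Lemma Rintegral_powR r u : r + 1 != 0 -> 0 < u <= 1 ->
  \int[mu]_(x in `[u, 1]) x `^ r = (1 - u `^ (r + 1)) / (r + 1).
Proof.
move=> r1 /andP[u0 u1].
have [|x /andP[ux _]|_ /(_ 1)] := @continuous_indefinite_integral R u 1
    (fun x => (r + 1)^-1 * x `^ (r + 1)) (@powR R ^~ r).
- apply: continuous_in_subspaceT => x; rewrite inE/= in_itv/= => /andP[ux _].
  by apply: powR_continuous_pos; exact: lt_le_trans ux.
- have x0 : 0 < x by exact: lt_le_trans ux.
  have := is_deriveZ (r + 1)^-1 (is_derive1_powR (r + 1) x0).
  by rewrite addrK /GRing.scale/= mulrA mulVf// mul1r.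
- rewrite u1 lexx powR1 => /(_ isT) intE.
  by apply: (addrI ((r + 1)^-1 * u `^ (r + 1))); rewrite -intE; field.
Qed.

Lemma powR_sqrN p x : 0 < x -> (x `^ (- p)) ^+ 2 = x `^ (- (2 * p)).
Proof.
move=> x0; rewrite expr2 -powRD; last by rewrite (lt0r_neq0 x0) implybT.
by congr (_ `^ _); ring.
Qed.

(** The bound [p < 1/2] makes [x^(-p)] square integrable at 0. The function [l] below is the
    integral of [g t / t] over [[x, 1]], found by differentiating the L* equation. *)
Variable p : R.
Hypothesis p0 : 0 < p.
Hypothesis p2 : p < 2^-1.

Let g x := x `^ (- p).
Let l x := (x `^ (- p) - 1) / p.
Let h u := (1 - u `^ (1 - p)) / (1 - p).

Let p1_gt0 : 0 < 1 - p.
Proof. by have := p2; lra. Qed.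

Let p12_gt0 : 0 < 1 - 2 * p.
Proof. by have := p2; lra. Qed.

Let p1_neq0 : 1 - p != 0.
Proof. exact: lt0r_neq0. Qed.

Let p12_neq0 : 1 - 2 * p != 0.
Proof. exact: lt0r_neq0. Qed.

Let p_neq0 : p != 0.
Proof. exact: lt0r_neq0. Qed.

Let g_continuous u : 0 < u <= 1 -> {for u, continuous g}.
Proof. by move=> /andP[u0 _]; exact: powR_continuous_pos. Qed.

Let l_continuous u : 0 < u <= 1 -> {for u, continuous l}.
Proof.
move=> u01; apply: cvgM; last exact: cvg_cst.
by apply: cvgB; [exact: g_continuous|exact: cvg_cst].
Qed.

Let Rintegral_g u : 0 < u <= 1 -> \int[mu]_(x in `[u, 1]) g x = h u.
Proof.
by move=> u01; rewrite /h (addrC 1 (- p)); apply: Rintegral_powR => //; rewrite addrC.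
Qed.

Let Rintegral_gsqr u : 0 < u <= 1 ->
  \int[mu]_(x in `[u, 1]) g x ^+ 2 = (1 - u `^ (1 - 2 * p)) / (1 - 2 * p).
Proof.
move=> u01; have /andP[u0 _] := u01.
rewrite (_ : 1 - 2 * p = - (2 * p) + 1); last by ring.
rewrite -Rintegral_powR//; last by rewrite addrC.
apply: eq_Rintegral => x; rewrite inE/= in_itv/= => /andP[ux _].
by rewrite powR_sqrN// (lt_le_trans u0).
Qed.

Let intg u : 0 < u <= 1 -> mu.-integrable `[u, 1] (EFin \o g).
Proof. exact: powR_integrable_away_from0. Qed.

Let Rintegral_l u : 0 < u <= 1 ->
  \int[mu]_(x in `[u, 1]) l x = (h u - (1 - u)) / p.
Proof.
move=> u01; have /andP[_ u1] := u01.
rewrite RintegralZr//; last exact: (integrableB _ (intg u01) (integrable_itv_cst _ _ 1)).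
rewrite RintegralB//; [|exact: intg|exact: integrable_itv_cst].
by rewrite Rintegral_itv_cst// mul1r Rintegral_g.
Qed.

Let Rintegral_lsqr u : 0 < u <= 1 ->
  \int[mu]_(x in `[u, 1]) l x ^+ 2 =
  ((1 - u `^ (1 - 2 * p)) / (1 - 2 * p) - 2 * h u + (1 - u)) / p ^+ 2.
Proof.
move=> u01; have /andP[_ u1] := u01.
rewrite (_ : \int[mu]_(x in _) _ =
    \int[mu]_(x in `[u, 1]) ((g x ^+ 2 - 2 * g x + 1) / p ^+ 2)); last first.
  by apply: eq_Rintegral => x _; rewrite /l /g; field.
have intg2 : mu.-integrable `[u, 1] (EFin \o (fun x => g x ^+ 2)).
  have /andP[u0 _] := u01.
  have := powR_integrable_away_from0 (- (2 * p)) u01; apply: eq_integrable => // x.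
  rewrite inE/= in_itv/= => /andP[ux _].
  by rewrite powR_sqrN// (lt_le_trans u0).
have int2g : mu.-integrable `[u, 1] (EFin \o (fun x => 2 * g x)).
  exact: (integrableZl _ 2 (intg u01)).
have int1 := integrable_itv_cst u 1 1.
have intB : mu.-integrable `[u, 1] (EFin \o (fun x => g x ^+ 2 - 2 * g x)).
  exact: (integrableB _ intg2 int2g).
rewrite RintegralZr//; last exact: (integrableD _ intB int1).
rewrite RintegralD// RintegralB// RintegralZl//; last exact: intg.
by rewrite Rintegral_itv_cst// mul1r Rintegral_g// Rintegral_gsqr.
Qed.

Let powR_head_cvg r : 0 < r -> (1 - x `^ r) / r @[x --> 0^'+] --> r^-1.
Proof.
move=> r0; rewrite -[X in _ --> X]mul1r; apply: cvgM; last exact: cvg_cst.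
rewrite -[X in _ --> X]subr0; apply: cvgB; first exact: cvg_cst.
exact: powR_cvg0.
Qed.

Let sq_integral_g : sq_integral g = ((1 - 2 * p)^-1)%:E.
Proof.
apply: (sq_integral_eq g_continuous Rintegral_gsqr).
by apply: powR_head_cvg.
Qed.

Let sq_integral_l :
  sq_integral l = (((1 - 2 * p)^-1 - 2 * (1 - p)^-1 + 1) / p ^+ 2)%:E.
Proof.
apply: (sq_integral_eq l_continuous Rintegral_lsqr).
apply: cvgM; last exact: cvg_cst.
apply: cvgD.
  apply: cvgB; first by apply: powR_head_cvg.
  by apply: cvgM; [exact: cvg_cst|apply: powR_head_cvg].
rewrite -[X in _ --> X]subr0; apply: cvgB; first exact: cvg_cst.
exact/cvg_at_right_filter/cvg_id.
Qed.

Lemma power_ratio :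
  exists (V : Type) (S : monotone_sampling_scheme R V) (f : V -> R)
         (v : V) (fv : R -> R) (fL : R -> V -> R),
    [/\ forall z, 0 <= f z,
        is_v_optimal S f v fv,
        is_Lstar S f fL,
        (sq_integral fv < +oo)%E &
        (2 / (1 - p))%:E = (sq_integral (fL ^~ v) / sq_integral fv)%E].
Proof.
have -> : (2 / (1 - p))%:E = (sq_integral l / sq_integral g)%E.
  rewrite sq_integral_g sq_integral_l inver invr_eq0 (negbTE p12_neq0) -EFinM.
  (* The square integral of [l] simplifies to [2 / ((1 - p) * (1 - 2 * p))]. *)
  by congr EFin; field; rewrite p_neq0 p1_neq0 p12_neq0.
apply: (@threshold_ratio _ _ _ h).
- by move=> u _; exact: powR_ge0.
- move=> u u' u0 uu' u'1; rewrite /g !powRN lef_pV2 ?posrE ?powR_gt0 ?(lt_le_trans u0)//.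
  by apply: ge0_ler_powR; rewrite ?nnegrE// ltW// (lt_le_trans u0).
- exact: g_continuous.
- exact: l_continuous.
- by move=> u u01; rewrite Rintegral_g.
- move=> u /andP[u0 u1]; rewrite /h ler_pM2r ?invr_gt0//.
  by rewrite lerB// powR0// powR_ge0.
- move=> u u01; have /andP[u0 _] := u01; rewrite Rintegral_l// /l /h.
  have -> : u `^ (1 - p) = u * u `^ (- p).
    by rewrite powRD ?(lt0r_neq0 u0) ?implybT// powRr1// ltW.
  by field; rewrite p_neq0 p1_neq0.
- by rewrite sq_integral_g ltry.
Qed.

End power_functions.

(** * The supremum from both bounds *)

Theorem theorem4p1 (R : realType) :
  ereal_sup
    [set r : \bar R |
      exists (V : Type) (S : monotone_sampling_scheme R V) (f : V -> R)
             (v : V) (fv : R -> R) (fL : R -> V -> R),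
        [/\ forall z, 0 <= f z,
            is_v_optimal S f v fv,
            is_Lstar S f fL,
            (sq_integral fv < +oo)%E &
            r = (sq_integral (fL ^~ v) / sq_integral fv)%E]]
  = (4 : R)%:E.
Proof.
apply/eqP; rewrite eq_le; apply/andP; split.
  apply: ge_ereal_sup => r [V [S [f [v [fv [fL [f0 fvopt fLstar fvsq ->]]]]]]].
  have := Lstar_4competitive f0 fvopt fvsq fLstar.
  have fv0 : (0 <= sq_integral fv)%E.
    by apply: integral_ge0 => x _; rewrite lee_fin sqr_ge0.
  have fL0 : (0 <= sq_integral (fL ^~ v))%E.
    by apply: integral_ge0 => x _; rewrite lee_fin sqr_ge0.
  (* If the denominator vanishes, 4-competitiveness forces the numerator to vanish too, and the
     ratio is 0. *)
  rewrite le_eqVlt in fv0; case/orP: fv0 => [/eqP<-|fv0].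
    rewrite mule0 => fL_le0.
    have -> : sq_integral (fL ^~ v) = 0%E by apply/eqP; rewrite eq_le fL_le0 fL0.
    by rewrite mul0e.
  have fvE : sq_integral fv = (fine (sq_integral fv))%:E.
    by rewrite fineK// ge0_fin_numE// ltW.
  rewrite fvE lte_fin in fv0.
  by rewrite fvE inver gt_eqF// lee_pdivrMr.
apply/lee_addgt0Pr => e e0.
(* For [p = 1/2 - d] the ratio is [4 / (1 + 2 * d)], at least [4 - 8 * d] and hence at least
   [4 - e]; the cap [1/4] keeps [p] positive. *)
pose d := Num.min (e / 8) 4^-1.
have d0 : 0 < d by rewrite lt_min divr_gt0//= invr_gt0.
have d4 : d <= 4^-1 by rewrite ge_min lexx orbT.
have de : 8 * d <= e by rewrite mulrC -ler_pdivlMr// ge_min lexx.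
pose p := 2^-1 - d.
have p0 : 0 < p by rewrite /p; lra.
have p2 : p < 2^-1 by rewrite /p; lra.
apply: (@le_trans _ _ ((2 / (1 - p))%:E + e%:E)%E).
  rewrite -EFinD lee_fin -lerBlDr ler_pdivlMr; last by rewrite /p; lra.
  rewrite /p; nra.
rewrite leeD2r//; apply: ereal_sup_ubound; exact: power_ratio.
Qed.
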